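(* Let $(X,\mathcal{M},\mu)$ be a non-atomic measure space and $\Phi$ an $N^*$-function. Then every continuous linear functional on $(L_\Phi(X),d_\Phi)$ is identically zero, i.e. $L_\Phi(X)^*=\{0\}$.
   Context: An $N^*$-function is a function $\Phi:\mathbb{R}\to\mathbb{R}$ of the form $\Phi(x)=\int_0^{|x|}p(t)\,dt<+\infty$ for all $x$, where $p:[0,\infty)\to[0,\infty]$ is right-continuous, positive on $(0,\infty)$, non-increasing, and satisfies $\lim_{t\to0^+}p(t)=+\infty$ and $\lim_{t\to+\infty}p(t)=0$. $L_\Phi(X)$ is the space of (classes modulo a.e. equality of) measurable $f$ with $\int_X\Phi(f)\,d\mu<\infty$, with metric $d_\Phi(f,g)=\int_X\Phi(f-g)\,d\mu$. The measure space is non-atomic if every $A\in\mathcal{M}$ with $\mu(A)>0$ contains a measurable $B$ with $0<\mu(B)<\mu(A)$. *)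

(* Defs.v *)
From HB Require Import structures.
From mathcomp Require Import all_boot all_order all_algebra.
From mathcomp Require Import all_classical all_reals all_analysis.
Set Implicit Arguments. Unset Strict Implicit. Unset Printing Implicit Defensive.
Import Order.TTheory GRing.Theory Num.Theory.
Import numFieldNormedType.Exports.
Local Open Scope classical_set_scope.
Local Open Scope ring_scope.

(* The density p of an N*-function: p : [0,+oo) -> [0,+oo], given as a map
   R -> \bar R whose values on negative reals are irrelevant. *)
Definition Nstar_density (R : realType) (p : R -> \bar R) : Prop :=
  (forall t, 0 <= t -> (0 <= p t)%E) /\
  (forall t, 0 <= t -> p s @[s --> t^'+] --> p t) /\
  (forall t, 0 < t -> (0 < p t)%E) /\
  (forall s t, 0 <= s -> s <= t -> (p t <= p s)%E) /\
  (p s @[s --> 0^'+] --> +oo%E) /\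
  (p s @[s --> +oo] --> 0%E).

Definition Phi_of (R : realType) (p : R -> \bar R) (x : R) : \bar R :=
  (\int[lebesgue_measure]_(t in `[0%R, `|x|%R]) p t)%E.

Definition Nstar_function (R : realType) (Phi : R -> R) : Prop :=
  exists p : R -> \bar R, [/\ Nstar_density p,
    (forall x, (Phi_of p x < +oo)%E) &
    (forall x, (Phi x)%:E = Phi_of p x)].

Definition nonatomic (d : measure_display) (T : measurableType d) (R : realType)
  (mu : {measure set T -> \bar R}) : Prop :=
  forall A, measurable A -> (0 < mu A)%E ->
    exists B, [/\ measurable B, B `<=` A, (0 < mu B)%E & (mu B < mu A)%E].

(* The Orlicz-type class L_Phi(X) (representatives; a.e.-classes are handled
   through the metric). *)
Definition L_Phi (d : measure_display) (T : measurableType d) (R : realType)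
  (mu : {measure set T -> \bar R}) (Phi : R -> R) : set (T -> R) :=
  [set f | measurable_fun setT f /\ (\int[mu]_x (Phi (f x))%:E < +oo)%E].

Definition d_Phi (d : measure_display) (T : measurableType d) (R : realType)
  (mu : {measure set T -> \bar R}) (Phi : R -> R) (f g : T -> R) : \bar R :=
  (\int[mu]_x (Phi (f x - g x))%:E)%E.

Definition linear_on_L (d : measure_display) (T : measurableType d) (R : realType)
  (mu : {measure set T -> \bar R}) (Phi : R -> R) (Lam : (T -> R) -> R) : Prop :=
  forall f g, L_Phi mu Phi f -> L_Phi mu Phi g -> forall a b : R,
    Lam (fun x => a * f x + b * g x) = a * Lam f + b * Lam g.

Definition continuous_on_L (d : measure_display) (T : measurableType d) (R : realType)
  (mu : {measure set T -> \bar R}) (Phi : R -> R) (Lam : (T -> R) -> R) : Prop :=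
  forall f, L_Phi mu Phi f -> forall e : R, 0 < e -> exists2 delta : R, 0 < delta &
    forall g, L_Phi mu Phi g -> (d_Phi mu Phi f g < delta%:E)%E ->
      `|Lam g - Lam f| < e.

(* Main.v *)
(** Since [p] decreases to [0], [Phi] satisfies [Phi (2 x) <= 2 Phi x] and
    [Phi y / y --> 0] at infinity, so by dominated convergence
    [I_n := 2^-n \int Phi (2^n f)] tends to [0].  The finite measure
    [nu A := \int_A Phi (2^n f)] is again non-atomic, so sets can be halved
    exactly with respect to [nu] (Sierpinski).  Halving [n] times, each time
    keeping the half on which the functional [Lam] is larger, gives [B] with
    [nu B = I_n] and [|Lam (f 1_B)| >= 2^-n |Lam f|].  Then [2^n f 1_B] is at
    distance [I_n] from [0] while [|Lam (2^n f 1_B)| >= |Lam f|], which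
    contradicts continuity at [0] unless [Lam f = 0]. *)

Require Import Defs.
From HB Require Import structures.
From mathcomp Require Import all_boot all_order all_algebra.
From mathcomp Require Import all_classical all_reals all_analysis.
From mathcomp Require Import measurable_realfun lra.
Import Order.TTheory GRing.Theory Num.Theory.
Import numFieldNormedType.Exports.
Local Open Scope classical_set_scope.
Local Open Scope ring_scope.

(** * Sierpinski's theorem: a non-atomic measure takes all intermediate values *)

(* Greedy exhaustion: each step captures at least half of the measure that can
   still be added, so nothing can be added to the union. *)
Lemma exists_maximal_measurable (d : measure_display) (T : measurableType d)
    (R : realType) (nu : {measure set T -> \bar R}) (A : set T) (t : R) :
  measurable A -> 0 <= t ->
  exists E, [/\ measurable E, E `<=` A, (nu E <= t%:E)%E &
    forall D, measurable D -> E `<=` D -> D `<=` A -> (nu D <= t%:E)%E ->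
      (nu D <= nu E)%E].
Proof.
move=> mA t0.
pose adm E := [/\ measurable E, E `<=` A & (nu E <= t%:E)%E].
have fin E : adm E -> nu E \is a fin_num.
  move=> [mE _ Et]; rewrite ge0_fin_numE ?measure_ge0//.
  exact: le_lt_trans Et (ltry _).
(* The inequality says that [nu E' - nu E] is at least half of [nu D - nu E] for every competitor
   [D], written without subtraction. *)
have step E : exists E', adm E -> [/\ adm E', E `<=` E' &
    forall D, adm D -> E `<=` D ->
      fine (nu D) + fine (nu E) <= fine (nu E') *+ 2].
  (* [set0] is a dummy value outside the admissible sets, so that [choice] can yield a total map
     [F]. *)
  have [aE|] := pselect (adm E); last by exists set0.
  pose S := [set fine (nu D) | D in [set D | adm D /\ E `<=` D]].
  have SE : S (fine (nu E)) by exists E => //; split.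
  have supS : has_sup S.
    split; first by exists (fine (nu E)).
    exists t => _ [D [aD _] <-]; rewrite -lee_fin fineK ?fin//.
    by have [] := aD.
  have [sE|Es] := leP (sup S) (fine (nu E)).
    exists E => _; split => // D aD ED; rewrite mulr2n lerD2r.
    by apply: le_trans sE; apply: ub_le_sup; [case: supS|exists D].
  (* With half the gap as tolerance, the set found below has measure above the midpoint of [nu E]
     and [sup S]. *)
  have e0 : 0 < (sup S - fine (nu E)) / 2 by rewrite divr_gt0// subr_gt0.
  have [_ [D0 [aD0 ED0] <-] D0S] := sup_adherent e0 supS.
  exists D0 => _; split => // D aD ED.
  have : fine (nu D) <= sup S by apply: ub_le_sup; [case: supS|exists D].
  by rewrite mulr2n; lra.
have [F FP] := choice step.
pose E n := iter n F set0.
have aE n : adm (E n).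
  elim: n => [|n ih]; last by have [] := FP _ ih.
  by split; rewrite /E//= measure0 lee_fin.
have ndE : nondecreasing_seq E.
  by apply/nondecreasing_seqP => n; apply/subsetPset; have [] := FP _ (aE n).
have mE n : measurable (E n) by have [] := aE n.
have mU : measurable (\bigcup_n E n) by exact: bigcup_measurable.
have cE := nondecreasing_cvg_mu (mu := nu) mE mU ndE.
have Ut : (nu (\bigcup_n E n) <= t%:E)%E.
  rewrite -(cvg_lim _ cE)//; apply: lime_le; first by apply/cvg_ex; eexists; exact: cE.
  by apply: nearW => n; have [] := aE n.
have aU : adm (\bigcup_n E n).
  by split => // x [n _]; have [_ + _] := aE n; apply.
exists (\bigcup_n E n); split => //; first by case: aU.
move=> D mD UD DA Dt.
have aD : adm D by [].
have cfE : fine (nu (E n)) @[n --> \oo] --> fine (nu (\bigcup_n E n)).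
  apply: fine_cvg; rewrite fineK ?fin//; exact: cE.
have cfE' : fine (nu (E n.+1)) @[n --> \oo] --> fine (nu (\bigcup_n E n)).
  by rewrite (cvg_shiftS (fun n => fine (nu (E n)))).
rewrite -[leLHS]fineK ?fin// -[leRHS]fineK ?fin// lee_fin.
rewrite -(lerD2r (fine (nu (\bigcup_n E n)))) -mulr2n.
(* With [U] the union of the [E n], the limit of [nu D + nu (E n) <= 2 nu (E n.+1)] is
   [nu D + nu U <= 2 nu U], hence [nu D <= nu U]. *)
have c1 : fine (nu D) + fine (nu (E n)) @[n --> \oo] -->
    fine (nu D) + fine (nu (\bigcup_n E n)) by apply: cvgD => //; exact: cvg_cst.
have c2 : fine (nu (E n.+1)) *+ 2 @[n --> \oo] -->
    fine (nu (\bigcup_n E n)) *+ 2 by rewrite mulr2n; apply: cvgD.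
apply: ler_cvg_to c1 c2 _.
apply: nearW => n; have [_ _] := FP _ (aE n); apply => //.
by apply: subset_trans UD; exact: bigcup_sup.
Qed.

(** When [C] splits [B], the smaller of [C] and its complement in [B] still has positive measure, at
    most half that of [B]. Iterating from [A] divides the measure by at least [2 ^+ n]. *)
Lemma nonatomic_small_subset (d : measure_display) (T : measurableType d)
    (R : realType) (nu : {measure set T -> \bar R}) (A : set T) (e : R) :
  nonatomic nu -> measurable A -> (0 < nu A < +oo)%E -> 0 < e ->
  exists B, [/\ measurable B, B `<=` A & (0 < nu B < e%:E)%E].
Proof.
move=> na mA /andP[A0 Aoo] e0.
have half B : measurable B -> B `<=` A -> (0 < nu B)%E ->
    exists C, [/\ measurable C, C `<=` B, (0 < nu C)%E & (nu C *+ 2 <= nu B)%E].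
  move=> mB BA B0; have [C [mC CB C0 CltB]] := na B mB B0.
  have BE : nu B = (nu (B `\` C) + nu C)%E.
    by rewrite (measureDI nu mB mC) (setIidr CB).
  have mBC : measurable (B `\` C) by exact: measurableD.
  have [le|lt] := leP (nu C) (nu (B `\` C)).
    by exists C; split => //; rewrite BE mule2n leeD.
  exists (B `\` C); split => //.
  - rewrite lt0e measure_ge0 andbT; apply/eqP => z.
    by move: CltB; rewrite BE z add0e ltxx.
  - by rewrite BE mule2n leeD// ltW.
have iterhalf n : exists B, [/\ measurable B, B `<=` A, (0 < nu B)%E &
    (nu B * (2 ^+ n)%:E <= nu A)%E].
  elim: n => [|n [B [mB BA B0 Bn]]].
    by exists A; split => //; rewrite expr0 mule1.
  have [C [mC CB C0 C2]] := half _ mB BA B0.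
  exists C; split => //; first exact: subset_trans CB BA.
  apply: le_trans Bn; rewrite exprS EFinM muleA; apply: lee_wpmul2r.
    by rewrite lee_fin exprn_ge0.
  by rewrite muleC mule_natl.
have Afin : nu A \is a fin_num by rewrite ge0_fin_numE// ltW.
have fA0 : 0 < fine (nu A) by rewrite fine_gt0// A0.
have [n _ /(_ n (leqnn n)) /= nP] :=
  near_infty_natSinv_expn_lt (PosNum (divr_gt0 e0 fA0)).
have [B [mB BA B0 Bn]] := iterhalf n.
exists B; split => //; rewrite B0/=.
have p0 : (0 : R) < 2 ^+ n by rewrite exprn_gt0.
rewrite -(@lte_pmul2r _ (2 ^+ n)%:E)//.
apply: le_lt_trans Bn _; rewrite -(fineK Afin) -EFinM lte_fin.
by move: nP; rewrite ltr_pdivlMr// div1r mulrC ltr_pdivrMr.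
Qed.

(** If a maximal [E] with [nu E <= t] fell short of [t], then [A] minus [E] would contain a set of
    positive measure smaller than the gap, and adding it would contradict maximality. *)
Lemma nonatomic_intermediate_value (d : measure_display) (T : measurableType d)
    (R : realType) (nu : {measure set T -> \bar R}) (A : set T) (t : R) :
  nonatomic nu -> measurable A -> (nu A < +oo)%E -> 0 <= t -> (t%:E <= nu A)%E ->
  exists E, [/\ measurable E, E `<=` A & nu E = t%:E].
Proof.
move=> na mA Aoo t0 tA.
have [E [mE EA Et maxE]] := @exists_maximal_measurable _ _ _ nu A t mA t0.
exists E; split => //; apply/eqP; rewrite eq_le Et leNgt; apply/negP => ltE.
have Efin : nu E \is a fin_num.
  by rewrite ge0_fin_numE ?measure_ge0// (le_lt_trans Et) ?ltry.
have mAE : measurable (A `\` E) by exact: measurableD.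
have AEoo : (nu (A `\` E) < +oo)%E.
  by apply: le_lt_trans Aoo; rewrite le_measure ?inE//; exact: subDsetl.
have AE0 : (0 < nu (A `\` E))%E.
  rewrite lt0e measure_ge0 andbT; apply/eqP => z.
  have AE : nu A = (nu (A `\` E) + nu E)%E.
    by rewrite (measureDI nu mA mE) (setIidr EA).
  by move: (lt_le_trans ltE tA); rewrite AE z add0e ltxx.
have e0 : 0 < t - fine (nu E) by rewrite subr_gt0 -lte_fin fineK.
have := @nonatomic_small_subset _ _ _ nu _ _ na mAE _ e0.
rewrite AE0 AEoo => /(_ isT) [B [mB BAE /andP[B0 Blt]]].
have UE : nu (E `|` B) = (nu E + nu B)%E.
  by rewrite measureU//; apply/seteqP; split => // x [Ex /BAE[]].
have : (nu (E `|` B) <= nu E)%E.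
  have UA : E `|` B `<=` A by move=> x [/EA//|/BAE[]].
  apply: (maxE _ _ _ UA); [exact: measurableU|by move=> x Ex; left|].
  by rewrite UE -(fineK Efin) -leeBrDl// -EFinB ltW.
by rewrite UE leNgt lteDl// B0.
Qed.

(** * Measures given by a density, and their non-atomicity *)

Section density_measure.
Context (d : measure_display) (T : measurableType d) (R : realType).
Variables (mu : {measure set T -> \bar R}) (g : T -> \bar R).
Hypotheses (mg : measurable_fun setT g) (g0 : forall x, (0 <= g x)%E).

(* The two proof arguments make the measure instance below inferable. *)
Definition density_measure of measurable_fun setT g & (forall x, (0 <= g x)%E) :=
  fun A : set T => (\int[mu]_(x in A) g x)%E.

Local Notation nu := (density_measure mg g0).

Let nu0 : nu set0 = 0%E. Proof. exact: integral_set0. Qed.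

Let nu_ge0 A : (0 <= nu A)%E. Proof. exact: integral_ge0. Qed.

Let nu_sigma_additive : semi_sigma_additive nu.
Proof.
move=> F mF tF mUF; rewrite /density_measure ge0_integral_bigcup//.
  by apply: is_cvg_nneseries => n _ _; exact: integral_ge0.
exact: measurable_funTS.
Qed.

HB.instance Definition _ := isMeasure.Build d T R nu nu0 nu_ge0 nu_sigma_additive.

End density_measure.
Arguments density_measure {d T R} mu {g} mg g0.

Lemma integral_gt0 (d : measure_display) (T : measurableType d) (R : realType)
    (mu : {measure set T -> \bar R}) (A : set T) (g : T -> \bar R) :
  measurable A -> measurable_fun A g -> (forall x, A x -> (0 < g x)%E) ->
  (0 < mu A)%E -> (0 < \int[mu]_(x in A) g x)%E.
Proof.
move=> mA mg g0 A0; rewrite lt0e integral_ge0 ?andbT; last by move=> x /g0/ltW.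
apply/eqP => z.
have : (\int[mu]_(x in A) `|g x|)%E = 0%E.
  by rewrite -[RHS]z; apply: eq_integral => x /set_mem Ax; rewrite gee0_abs// ltW// g0.
move=> /(ae_eq_integral_abs mu mA mg) [N [mN N0 AN]].
have : (mu A <= mu N)%E.
  rewrite le_measure ?inE// => x Ax; apply: AN => /= /(_ Ax) gx0.
  by have := g0 x Ax; rewrite gx0 ltxx.
by rewrite N0 leNgt A0.
Qed.

(** The new measure lives on the part [A'] of [A] where [g] is positive. There positive [mu]-measure
    implies positive [nu]-measure, so a set splitting [A'] for [mu] also splits it for [nu]. *)
Lemma nonatomic_density (d : measure_display) (T : measurableType d)
    (R : realType) (mu : {measure set T -> \bar R}) (g : T -> \bar R)
    (mg : measurable_fun setT g) (g0 : forall x, (0 <= g x)%E) :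
  nonatomic mu -> (\int[mu]_x g x < +oo)%E ->
  nonatomic (density_measure mu mg g0).
Proof.
move=> na goo A mA A0.
set nu : {measure set T -> \bar R} := density_measure mu mg g0.
have nuE B : nu B = (\int[mu]_(x in B) g x)%E by [].
pose A' := A `&` [set x | (0 < g x)%E].
have mA' : measurable A'.
  exact: emeasurable_fun_o_infty mA (measurable_funTS mg) _.
have mD : measurable (A `\` A') by exact: measurableD.
have gpos B : measurable B -> B `<=` A' -> (0 < mu B)%E -> (0 < nu B)%E.
  move=> mB BA' B0; rewrite nuE; apply: integral_gt0 => //.
    exact: measurable_funTS.
  by move=> x /BA'[].
have nuA' : nu A = nu A'.
  have -> : nu A = (nu (A `\` A') + nu (A `&` A'))%E by exact: measureDI.
  rewrite (setIidr (@subIsetl _ A _)) [nu (A `\` A')]nuE integral0_eq ?add0e//.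
  move=> x [Ax nA'x]; apply/eqP; rewrite eq_le g0 andbT leNgt.
  by apply/negP => gx; exact: nA'x.
have muA' : (0 < mu A')%E.
  rewrite lt0e measure_ge0 andbT; apply/eqP => z.
  move: A0; rewrite -/nu nuA' nuE null_set_integral ?ltxx//.
  exact: measurable_funTS.
have [B [mB BA' B0 BltA']] := na A' mA' muA'.
exists B; split => //.
- by move=> x /BA'[].
- exact: gpos.
have mC : measurable (A' `\` B) by exact: measurableD.
have nuC : (0 < nu (A' `\` B))%E.
  apply: gpos => //.
  have AE : mu A' = (mu (A' `\` B) + mu B)%E.
    by rewrite (measureDI mu mA' mB) (setIidr BA').
  rewrite lt0e measure_ge0 andbT; apply/eqP => z.
  by move: BltA'; rewrite AE z add0e ltxx.
have AE : nu A' = (nu (A' `\` B) + nu B)%E.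
  by rewrite (measureDI nu mA' mB) (setIidr BA').
(* The strict inequality rests on [nu B] being finite, which follows from the finite integral of
   [g]. *)
rewrite nuA' AE lteDr// ge0_fin_numE ?measure_ge0//.
apply: le_lt_trans goo; rewrite nuE ge0_subset_integral//.
Qed.

(** * Integral estimates for the non-increasing density [p] *)

Section Nstar_density_theory.
Context {R : realType} {p : R -> \bar R}.
Hypothesis Np : Nstar_density p.

Local Notation leb := (@lebesgue_measure R).

Let p_ge0 (t : R) : 0 <= t -> (0 <= p t)%E. Proof. by case: Np => + _; exact. Qed.

Let p_ni (s t : R) : 0 <= s -> s <= t -> (p t <= p s)%E.
Proof. by case: Np => _ [_ [_ [+ _]]]; exact. Qed.

Lemma measurable_Nstar_density (D : set R) :
  measurable D -> D `<=` `[0, +oo[ -> measurable_fun D p.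
Proof.
move=> mD D0; suff: measurable_fun (`[0, +oo[ : set R) p by exact: measurable_funS.
apply: (measurability _ (ErealGenCInfty.measurableE R)) => //.
(* By monotonicity of [p], its superlevel sets in the half-line are intervals. *)
move=> _ [_ [r ->] <-]; apply: is_interval_measurable => s t /=.
rewrite !in_itv/= !andbT => -[s0 ps] [t0 pt] u /andP[su ut].
have u0 : 0 <= u by exact: le_trans su.
by rewrite !in_itv/= !andbT; split => //; apply: le_trans pt _; exact: p_ni.
Qed.

Lemma integral_Nstar_density_split {a b : R} : 0 <= a -> a <= b ->
  (\int[leb]_(t in `[0%R, b]) p t =
   \int[leb]_(t in `[0%R, a]) p t + \int[leb]_(t in `]a, b]) p t)%E.
Proof.
move=> a0 ab.
have -> : [set` `[0, b]] = [set` `[0, a]] `|` [set` `]a, b]].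
  by rewrite -itv_bndbnd_setU// bnd_simp.
rewrite ge0_integral_setU//.
- apply: measurable_Nstar_density; first exact: measurableU.
  move=> x [] /=; rewrite !in_itv/= andbT => /andP[]// ax _.
  exact: le_trans (ltW ax).
- by move=> x [] /=; rewrite !in_itv/= => /andP[ax _]; apply: p_ge0 => //;
    exact: le_trans (ltW ax).
- apply/disj_setPS => x [] /=; rewrite !in_itv/= => /andP[_ xa] /andP[ax _].
  by have := le_lt_trans xa ax; rewrite ltxx.
Qed.

Lemma le_integral_Nstar_density {a b : R} : 0 <= a -> a <= b ->
  (\int[leb]_(t in `]a, b]) p t <= p a * (b - a)%:E)%E.
Proof.
move=> a0 ab; have <- : (leb `]a, b] = (b - a)%:E)%E.
  rewrite lebesgue_measure_itv/= lte_fin; have [//|ba] := ltP a b.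
  by rewrite (le_anti (x:=a) (y:=b)) ?ab// subrr.
rewrite -integral_cst//; apply: ge0_le_integral => //.
- by move=> x /=; rewrite in_itv/= => /andP[ax _]; apply/p_ge0/(le_trans a0)/ltW.
- apply: measurable_Nstar_density => // x /=; rewrite !in_itv/= andbT => /andP[ax _].
  exact: le_trans (ltW ax).
- by move=> x /=; rewrite in_itv/= => /andP[ax _]; apply: p_ni => //; exact: ltW.
Qed.

Lemma ge_integral_Nstar_density {a : R} : 0 <= a ->
  (p a * a%:E <= \int[leb]_(t in `[0%R, a]) p t)%E.
Proof.
move=> a0; have -> : (a%:E = leb `[0%R, a])%E.
  rewrite lebesgue_measure_itv/= lte_fin; have [|a0'] := ltP 0 a.
    by rewrite sube0.
  by rewrite (le_anti (x:=a) (y:=0)) ?a0'.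
rewrite -integral_cst//; apply: ge0_le_integral => //.
- by move=> x _; exact: p_ge0.
- apply: measurable_Nstar_density => // x /=; rewrite !in_itv/= andbT => /andP[ax _].
  exact: ax.
- by move=> x /=; rewrite in_itv/= => /andP[x0 xa]; exact: p_ni.
Qed.

End Nstar_density_theory.

(** * Monotonicity, doubling and sublinear growth of N*-functions *)

Section Nstar_function_theory.
Context {R : realType} {Phi : R -> R}.
Hypothesis NPhi : Nstar_function Phi.

Lemma Nstar_normr x : Phi `|x| = Phi x.
Proof.
by case: NPhi => p [_ _ PhiE]; apply: EFin_inj; rewrite !PhiE /Phi_of normr_id.
Qed.

Lemma Nstar0 : Phi 0 = 0.
Proof.
case: NPhi => p [_ _ PhiE]; apply: EFin_inj.
by rewrite PhiE /Phi_of normr0 set_itv1 integral_set1.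
Qed.

Lemma Nstar_ge0 x : 0 <= Phi x.
Proof.
case: NPhi => p [[p0 _] _ PhiE]; rewrite -lee_fin PhiE; apply: integral_ge0 => t /=.
by rewrite in_itv/= => /andP[t0 _]; exact: p0.
Qed.

Lemma le_Nstar x y : `|x| <= `|y| -> Phi x <= Phi y.
Proof.
case: NPhi => p [Np _ PhiE] xy; rewrite -lee_fin !PhiE /Phi_of.
rewrite (integral_Nstar_density_split Np (normr_ge0 x) xy) leeDl//.
apply: integral_ge0 => t /=; rewrite in_itv/= => /andP[xt _].
by case: Np => + _; apply; rewrite (le_trans _ (ltW xt)).
Qed.

(** Both the added integral over []|x|, 2|x|]] and the one over [[0, |x|]] are compared with
    [p |x| * |x|]: the first is at most this, the second at least. *)
Lemma Nstar_double x : Phi (2 * x) <= 2 * Phi x.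
Proof.
case: NPhi => p [Np _ PhiE].
rewrite -lee_fin EFinM !PhiE /Phi_of normrM ger0_norm//.
have xx : `|x| <= 2 * `|x| by rewrite ler_peMl// ler1n.
rewrite (integral_Nstar_density_split Np (normr_ge0 x) xx).
rewrite mule_natl mule2n leeD2l//.
apply: le_trans (ge_integral_Nstar_density Np (normr_ge0 x)).
apply: le_trans (le_integral_Nstar_density Np (normr_ge0 x) xx) _.
by rewrite mulr_natl mulr2n addrK.
Qed.

(** As [p] tends to 0, some [a] has [p a <= e]; beyond [a] the slope is at most [e], and
    [M := Phi a] covers the rest. *)
Lemma Nstar_sublinear {e : R} : 0 < e ->
  exists2 M, 0 <= M & forall x, Phi x <= M + e * `|x|.
Proof.
case: NPhi => p [Np _ PhiE] e0.
have [a a0 pa] : exists2 a, 0 <= a & (p a <= e%:E)%E.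
  have [_ [_ [_ [_ [_ p_0]]]]] := Np.
  have pe : \forall s \near +oo, (p s < e%:E)%E.
    have e0' : (0 < e%:E)%E by rewrite lte_fin.
    exact: p_0 (open_ereal_lt' e0').
  near (@pinfty_nbhs R) => a; exists a.
    by near: a; exact: nbhs_pinfty_ge.
  by apply: ltW; near: a.
exists (Phi a); first exact: Nstar_ge0.
move=> x; have [xa|ax] := leP `|x| a.
  apply: (@le_trans _ _ (Phi a)); first by rewrite le_Nstar// (ger0_norm a0).
  by rewrite lerDl mulr_ge0// ltW.
rewrite -lee_fin EFinD !PhiE /Phi_of (ger0_norm a0).
rewrite (integral_Nstar_density_split Np a0 (ltW ax)) leeD2l//.
apply: le_trans (le_integral_Nstar_density Np a0 (ltW ax)) _.
rewrite EFinM; apply: (@le_trans _ _ (e%:E * (`|x| - a)%:E)%E).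
  by rewrite lee_wpmul2r// lee_fin subr_ge0 ltW.
by rewrite -!EFinM lee_fin ler_wpM2l ?(ltW e0)// gerBl.
Unshelve. all: by end_near. Qed.

Lemma measurable_Nstar : measurable_fun setT Phi.
Proof.
(* Truncating the argument at 0 makes [Phi] monotone on the whole line; evenness then recovers [Phi]
   by composing with the norm. *)
have -> : Phi = (fun x => Phi (Num.max 0 x)) \o Num.norm.
  by apply/funext => x /=; rewrite max_r// Nstar_normr.
apply: measurableT_comp => //; apply: nondecreasing_measurable => // x y xy.
have max0 z : (0 : R) <= Num.max 0 z by rewrite le_max lexx.
by apply: le_Nstar; rewrite !ger0_norm// ge_max max0/= le_max xy orbT.
Qed.

Lemma Nstar_expn n x : Phi (2 ^+ n * x) <= 2 ^+ n * Phi x.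
Proof.
elim: n => [|n ih]; first by rewrite !expr0 !mul1r.
by rewrite !exprS -!mulrA (le_trans (Nstar_double _))// ler_pM2l.
Qed.

Lemma cvg_Nstar_expn x : (2 ^+ n)^-1 * Phi (2 ^+ n * x) @[n --> \oo] --> 0.
Proof.
apply/cvgrPdist_le => e e0.
(* Each error term is to be at most [e / 2]. The added 1, here and in [M + 1], keeps the
   denominators positive when [x] or [M] is 0. *)
have e20 : 0 < e / 2 / (1 + `|x|) by rewrite !divr_gt0// ltr_pwDl.
have [M M0 PhiM] := Nstar_sublinear e20.
have eM : 0 < e / 2 / (M + 1) by rewrite !divr_gt0// ltr_wpDl.
near=> n.
rewrite sub0r normrN ger0_norm ?mulr_ge0 ?Nstar_ge0 ?invr_ge0 ?exprn_ge0//.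
have p0 : (0 : R) < 2 ^+ n by rewrite exprn_gt0.
have nM : 1 / 2 ^+ n < e / 2 / (M + 1).
  by near: n; exact: (near_infty_natSinv_expn_lt (PosNum eM)).
apply: (@le_trans _ _ (1 / 2 ^+ n * M + e / 2 / (1 + `|x|) * `|x|)).
  rewrite mulrC ler_pdivrMr//; have := PhiM (2 ^+ n * x).
  rewrite normrM (gtr0_norm p0) => /le_trans; apply.
  by rewrite mulrDl div1r [_^-1 * M]mulrC divfK ?gt_eqF// [2 ^+ n * _]mulrC mulrA.
rewrite [leRHS](splitr e) lerD//.
  apply: (@le_trans _ _ (e / 2 / (M + 1) * (M + 1))).
    by apply: ler_pM; [rewrite divr_ge0// ltW| |exact: ltW|rewrite lerDl].
  by rewrite divfK// gt_eqF// ltr_wpDl.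
rewrite -[leRHS](@divfK _ (1 + `|x|)) ?gt_eqF ?ltr_pwDl//.
by rewrite ler_wpM2l ?(ltW e20)// lerDr.
Unshelve. all: by end_near. Qed.

End Nstar_function_theory.

(** * Restriction, scaling and dominated convergence in [L_Phi] *)

Section L_Phi_theory.
Context {d : measure_display} {T : measurableType d} {R : realType}.
Context {mu : {measure set T -> \bar R}} {Phi : R -> R}.
Hypothesis NPhi : Nstar_function Phi.

Lemma measurable_Nstar_comp (f : T -> R) :
  measurable_fun setT f -> measurable_fun setT (fun x => (Phi (f x))%:E).
Proof.
by move=> mf; apply/measurable_EFinP; exact: measurableT_comp (measurable_Nstar NPhi) mf.
Qed.

Lemma integral_Nstar_restrict (f : T -> R) (B : set T) : measurable B ->
  (\int[mu]_x (Phi ((f \_ B) x))%:E = \int[mu]_(x in B) (Phi (f x))%:E)%E.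
Proof.
move=> mB; rewrite [RHS]integral_mkcond; apply: eq_integral => x _.
by rewrite /patch; case: ifP => // _; rewrite (Nstar0 NPhi).
Qed.

Lemma L_Phi_restrict (f : T -> R) (B : set T) : measurable B ->
  L_Phi mu Phi f -> L_Phi mu Phi (f \_ B).
Proof.
move=> mB [mf foo]; split.
  by apply/(measurable_restrictT _ _).1 => //; exact: measurable_funTS.
rewrite integral_Nstar_restrict//; apply: le_lt_trans foo.
apply: ge0_subset_integral => //.
- exact: measurable_Nstar_comp.
- by move=> x _; rewrite lee_fin (Nstar_ge0 NPhi).
Qed.

Lemma L_Phi_expn (f : T -> R) n :
  L_Phi mu Phi f -> L_Phi mu Phi (fun x => 2 ^+ n * f x).
Proof.
move=> [mf foo]; split; first exact: measurable_funM.
have mPf := measurable_Nstar_comp _ mf.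
apply: (@le_lt_trans _ _ (\int[mu]_x ((2 ^+ n)%:E * (Phi (f x))%:E))%E).
  apply: ge0_le_integral => //.
  - by move=> x _; rewrite lee_fin (Nstar_ge0 NPhi).
  - by apply: measurable_Nstar_comp; exact: measurable_funM.
  - exact: measurable_funeM.
  - by move=> x _; rewrite -EFinM lee_fin (Nstar_expn NPhi).
rewrite ge0_integralZl_EFin//.
- by rewrite lte_mul_pinfty// ?lee_fin// ?ge0_fin_numE.
- by move=> x _; rewrite lee_fin (Nstar_ge0 NPhi).
Qed.

(** Iterated doubling bounds every integrand by the integrable function [Phi (f x)], while sublinear
    growth gives pointwise convergence. *)
Lemma cvg_integral_Nstar_expn (f : T -> R) : L_Phi mu Phi f ->
  (\int[mu]_x ((2 ^+ n)^-1 * Phi (2 ^+ n * f x))%:E @[n --> \oo] --> 0)%E.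
Proof.
move=> [mf foo]; rewrite -[0%E](@integral0 _ _ _ mu setT).
apply: (@dominated_cvg _ _ _ mu setT measurableT _ _ (fun x => (Phi (f x))%:E)) => //.
- move=> n; under eq_fun do rewrite EFinM.
  apply: measurable_funeM; apply: measurable_Nstar_comp.
  exact: measurable_funM.
- by move=> x _; apply: cvg_EFin; [exact: nearW|exact: cvg_Nstar_expn].
- apply/integrableP; split; first exact: measurable_Nstar_comp.
  by under eq_integral do rewrite gee0_abs ?lee_fin ?(Nstar_ge0 NPhi)//.
- move=> n x _; have p0 : (0 : R) < 2 ^+ n by rewrite exprn_gt0.
  rewrite gee0_abs ?lee_fin ?mulr_ge0 ?invr_ge0 ?(ltW p0) ?(Nstar_ge0 NPhi)//.
  by rewrite ler_pdivrMl// (Nstar_expn NPhi).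
Qed.

(** * Halving a measure while controlling a linear functional *)

Section functional.
Context {Lam : (T -> R) -> R}.
Hypothesis linLam : linear_on_L mu Phi Lam.

(* Of two halves of equal measure, keep the one carrying more of [Lam]. *)
Lemma functional_halving (nu : {measure set T -> \bar R}) (f : T -> R) (n : nat) :
  nonatomic nu -> (nu setT < +oo)%E -> L_Phi mu Phi f ->
  exists B, [/\ measurable B, nu B = (fine (nu setT) / 2 ^+ n)%:E &
    `|Lam f| <= 2 ^+ n * `|Lam (f \_ B)|].
Proof.
move=> na nuoo Lf; have V0 : 0 <= fine (nu setT) by rewrite fine_ge0.
elim: n => [|n [B [mB nuB LB]]].
  exists setT; split => //; last by rewrite expr0 mul1r patch_setT.
  by rewrite expr0 divr1 fineK// ge0_fin_numE.
have q0 : 0 <= fine (nu setT) / 2 ^+ n.+1 by rewrite divr_ge0// exprn_ge0.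
have BE : nu B = (fine (nu setT) / 2 ^+ n.+1 + fine (nu setT) / 2 ^+ n.+1)%:E.
  by rewrite nuB exprS invfM [2^-1 * _]mulrC mulrA -splitr.
have Boo : (nu B < +oo)%E by rewrite nuB ltry.
have qB : ((fine (nu setT) / 2 ^+ n.+1)%:E <= nu B)%E by rewrite BE lee_fin lerDl.
have [C [mC CB nuC]] := nonatomic_intermediate_value _ _ _ nu B _ na mB Boo q0 qB.
have mBC : measurable (B `\` C) by exact: measurableD.
have nuBC : nu (B `\` C) = (fine (nu setT) / 2 ^+ n.+1)%:E.
  by rewrite measureD// (setIidr CB) [X in (_ - X)%E]nuC [X in (X - _)%E]BE -EFinB addrK.
(* The restrictions of [f] to [C] and to its complement in [B] add up to [f \_ B], since [C] lies in
   [B]. *)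
have LE : Lam (f \_ B) = Lam (f \_ (B `\` C)) + Lam (f \_ C).
  rewrite -[X in X + _]mul1r -[X in _ + X]mul1r -linLam; try exact: L_Phi_restrict.
  congr Lam; apply/funext => x; rewrite !mul1r /patch in_setD.
  have [xC|xC] := boolP (x \in C); last by rewrite andbT addr0.
  by rewrite andbF add0r; move: xC; rewrite inE => /CB xB; rewrite mem_set.
have [le|lt] := leP `|Lam (f \_ (B `\` C))| `|Lam (f \_ C)|.
  exists C; split => //; apply: (le_trans LB).
  rewrite exprSr -mulrA ler_pM2l ?exprn_gt0// LE (le_trans (ler_normD _ _))//.
  by rewrite mulr_natl mulr2n lerD2r.
exists (B `\` C); split => //; apply: (le_trans LB).
rewrite exprSr -mulrA ler_pM2l ?exprn_gt0// LE (le_trans (ler_normD _ _))//.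
by rewrite mulr_natl mulr2n lerD2l ltW.
Qed.

End functional.
End L_Phi_theory.

Theorem mainTheorem18 (d : measure_display) (T : measurableType d) (R : realType)
  (mu : {measure set T -> \bar R}) (Phi : R -> R) :
  nonatomic mu -> Nstar_function Phi ->
  forall Lam : (T -> R) -> R,
    linear_on_L mu Phi Lam -> continuous_on_L mu Phi Lam ->
    forall f, L_Phi mu Phi f -> Lam f = 0.
Proof.
move=> na NPhi Lam linLam ctsLam f Lf.
have [//|Lf0] := eqVneq (Lam f) 0.
have L0 : L_Phi mu Phi (fun=> 0).
  split => //; rewrite integral0_eq// => x _; by rewrite (Nstar0 NPhi).
have Lam0 : Lam (fun=> 0) = 0.
  by have := linLam _ _ L0 L0 0 0; rewrite !mul0r addr0.
have [delta delta0 dLam] : exists2 delta : R, 0 < delta & forall g, L_Phi mu Phi g ->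
    (\int[mu]_x (Phi (g x))%:E < delta%:E)%E -> `|Lam g| < `|Lam f|.
  have [|delta delta0 dP] := ctsLam _ L0 `|Lam f|; first by rewrite normr_gt0.
  exists delta => // g Lg gd; have := dP g Lg; rewrite Lam0 subr0; apply.
  (* The distance from 0 to [g] integrates [Phi (0 - g x)]; evenness of [Phi] removes the sign. *)
  rewrite /d_Phi; under eq_integral do
    rewrite sub0r -(Nstar_normr NPhi) normrN (Nstar_normr NPhi).
  exact: gd.
have [n nd] : exists n,
    (\int[mu]_x ((2 ^+ n)^-1 * Phi (2 ^+ n * f x))%:E < delta%:E)%E.
  have d0 : (0 < delta%:E)%E by rewrite lte_fin.
  have [n _ /(_ n (leqnn n)) nd] :=
    cvg_integral_Nstar_expn NPhi _ Lf _ (open_ereal_lt' d0).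
  by exists n.
pose g x := 2 ^+ n * f x.
have Lg : L_Phi mu Phi g by exact: L_Phi_expn.
have mPg : measurable_fun setT (fun x => (Phi (g x))%:E).
  by apply: (measurable_Nstar_comp NPhi); case: Lg.
have Pg0 x : (0 <= (Phi (g x))%:E)%E by rewrite lee_fin (Nstar_ge0 NPhi).
pose nu : {measure set T -> \bar R} := density_measure mu mPg Pg0.
have nuE B : nu B = (\int[mu]_(x in B) (Phi (g x))%:E)%E by [].
have nuoo : (nu setT < +oo)%E by case: Lg.
have nuna : nonatomic nu by apply: nonatomic_density => //; case: Lg.
have [B [mB nuB LB]] :=
  functional_halving NPhi linLam nu f n nuna nuoo Lf.
have LfB : L_Phi mu Phi (f \_ B) by exact: L_Phi_restrict.
have gBE : g \_ B = (fun x => 2 ^+ n * (f \_ B) x).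
  by apply/funext => x; rewrite /patch; case: ifP => // _; rewrite mulr0.
have : `|Lam (g \_ B)| < `|Lam f|.
  apply: dLam; first exact: L_Phi_restrict.
  rewrite integral_Nstar_restrict// -nuE nuB.
  (* The mass [nu B] is exactly the scaled integral that the choice of [n] made smaller than
     [delta]. *)
  suff <- : (\int[mu]_x ((2 ^+ n)^-1 * Phi (g x))%:E =
      (fine (nu setT) / 2 ^+ n)%:E)%E by [].
  under eq_integral do rewrite EFinM.
  rewrite ge0_integralZl_EFin ?invr_ge0 ?exprn_ge0// -nuE mulrC EFinM fineK//.
  by rewrite ge0_fin_numE.
have -> : Lam (g \_ B) = 2 ^+ n * Lam (f \_ B).
  (* Homogeneity is extracted from two-term linearity by adding a summand with coefficient 0. *)
  rewrite gBE -[RHS]addr0 -[X in _ = _ + X](mul0r (Lam (f \_ B))) -linLam//.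
  by congr Lam; apply/funext => x; rewrite mul0r addr0.
by rewrite normrM ger0_norm ?exprn_ge0// ltNge LB.
Qed.
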